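(* Let $\mathcal C$ be a Barr-exact category and let $F\colon \mathbb H\to\mathbb G$ be an internal functor between internal groupoids in $\mathcal C$. Then $F$ is final if and only if $F$ is full and essentially surjective.
   Context: A Barr-exact category is a finitely complete regular category in which every internal equivalence relation is effective. An internal groupoid $\mathbb H$ in $\mathcal C$ has object of objects $H_0$, object of arrows $H_1$, domain and codomain $d,c\colon H_1\to H_0$, identities $e\colon H_0\to H_1$, composition $m\colon H_1\times_{(c,d)}H_1\to H_1$ (with $H_1\times_{(c,d)}H_1$ the pullback of $c$ along $d$) and inversion $i\colon H_1\to H_1$, satisfying the usual axioms. An internal functor $F\colon\mathbb H\to\mathbb G$ is a pair $F=(f_0,f_1)$ of morphisms $f_0\colon H_0\to G_0$, $f_1\colon H_1\to G_1$ compatible with $d,c,e,m$. $\mathsf{Gpd}(\mathcal C)$ is the category of internal groupoids and internal functors in $\mathcal C$. Discrete fibration: $F=(f_0,f_1)\colon\mathbb H\to\mathbb G$ is a discrete fibration if the commutative square $f_0\, c=c\, f_1$ exhibits $H_1$ as the pullback of $c\colon G_1\to G_0$ along $f_0\colon H_0\to G_0$. Final: $F$ is final if it is (left) orthogonal in $\mathsf{Gpd}(\mathcal C)$ to every discrete fibration, i.e. for every discrete fibration $K\colon\mathbb A\to\mathbb B$ and functors $U\colon\mathbb H\to\mathbb A$, $V\colon\mathbb G\to\mathbb B$ with $KU=VF$ there is a unique functor $D\colon\mathbb G\to\mathbb A$ with $DF=U$ and $KD=V$. Full: let $P$ be the pullback of $(d,c)\colon G_1\to G_0\times G_0$ along $f_0\times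 f_0\colon H_0\times H_0\to G_0\times G_0$, and let $\phi_F\colon H_1\to P$ be the morphism induced by $(d,c)\colon H_1\to H_0\times H_0$ and $f_1\colon H_1\to G_1$. $F$ is full if $\phi_F$ is a regular epimorphism. Essentially surjective: let $E_0$ be the pullback of $d\colon G_1\to G_0$ along $f_0\colon H_0\to G_0$, with projection $\overline{f_0}\colon E_0\to G_1$. $F$ is essentially surjective if the composite $c\cdot\overline{f_0}\colon E_0\to G_0$ is a regular epimorphism. *)

(* Defs.v *)
From Stdlib Require Import ProofIrrelevance.

Set Implicit Arguments.
Unset Strict Implicit.
Unset Printing Implicit Defensive.

(** * Categories *)

Record Category : Type := {
  Ob :> Type;
  Hom : Ob -> Ob -> Type;
  idm : forall X, Hom X X;
  comp : forall X Y Z, Hom Y Z -> Hom X Y -> Hom X Z;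
  comp_idl : forall X Y (f : Hom X Y), comp (idm Y) f = f;
  comp_idr : forall X Y (f : Hom X Y), comp f (idm X) = f;
  comp_assoc : forall W X Y Z (h : Hom Y Z) (g : Hom X Y) (f : Hom W X),
    comp h (comp g f) = comp (comp h g) f
}.

Arguments Hom {c} _ _.
Arguments idm {c} X.
Arguments comp {c X Y Z} _ _.

Notation "g ∘ f" := (comp g f) (at level 40, left associativity).

(** [K] on the right: [F] is left orthogonal to [K]. *)
Definition orthogonal (C : Category) (X Y A B : C)
    (F : Hom X Y) (K : Hom A B) : Prop :=
  forall (U : Hom X A) (V : Hom Y B), K ∘ U = V ∘ F ->
    exists! D : Hom Y A, D ∘ F = U /\ K ∘ D = V.

Definition is_terminal (C : Category) (T : C) : Prop :=
  forall X : C, exists! h : Hom X T, True.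

Definition is_product (C : Category) (X Y P : C)
    (p1 : Hom P X) (p2 : Hom P Y) : Prop :=
  forall (W : C) (x : Hom W X) (y : Hom W Y),
    exists! h : Hom W P, p1 ∘ h = x /\ p2 ∘ h = y.

(** The square [f ∘ p1 = g ∘ p2] is a pullback. *)
Definition is_pullback (C : Category) (X Y Z P : C)
    (f : Hom X Z) (g : Hom Y Z) (p1 : Hom P X) (p2 : Hom P Y) : Prop :=
  f ∘ p1 = g ∘ p2 /\
  forall (W : C) (x : Hom W X) (y : Hom W Y), f ∘ x = g ∘ y ->
    exists! h : Hom W P, p1 ∘ h = x /\ p2 ∘ h = y.

Definition is_coequalizer (C : Category) (R X Q : C)
    (u v : Hom R X) (q : Hom X Q) : Prop :=
  q ∘ u = q ∘ v /\
  forall (W : C) (x : Hom X W), x ∘ u = x ∘ v ->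
    exists! h : Hom Q W, h ∘ q = x.

Definition regular_epi (C : Category) (X Q : C) (q : Hom X Q) : Prop :=
  exists (R : C) (u v : Hom R X), is_coequalizer u v q.

Definition jointly_monic (C : Category) (R X Y : C)
    (r1 : Hom R X) (r2 : Hom R Y) : Prop :=
  forall (W : C) (a b : Hom W R),
    r1 ∘ a = r1 ∘ b -> r2 ∘ a = r2 ∘ b -> a = b.

(** * Finitely complete categories

    Finite limits are given by a choice of a terminal object, binary products
    and pullbacks; binary products are kept primitive so that [G0 × G0] need not
    be read as a pullback over the terminal object. *)

Record FinitelyComplete (C : Category) : Type := {
  one : C;
  one_terminal : is_terminal one;

  prod : C -> C -> C;
  fst : forall X Y, Hom (prod X Y) X;
  snd : forall X Y, Hom (prod X Y) Y;
  pair : forall W X Y, Hom W X -> Hom W Y -> Hom W (prod X Y);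
  pair_fst : forall W X Y (x : Hom W X) (y : Hom W Y), fst X Y ∘ pair x y = x;
  pair_snd : forall W X Y (x : Hom W X) (y : Hom W Y), snd X Y ∘ pair x y = y;
  prod_jm : forall X Y, jointly_monic (fst X Y) (snd X Y);

  pb : forall X Y Z, Hom X Z -> Hom Y Z -> C;
  pr1 : forall X Y Z (f : Hom X Z) (g : Hom Y Z), Hom (pb f g) X;
  pr2 : forall X Y Z (f : Hom X Z) (g : Hom Y Z), Hom (pb f g) Y;
  pb_sq : forall X Y Z (f : Hom X Z) (g : Hom Y Z),
    f ∘ pr1 f g = g ∘ pr2 f g;
  pbpair : forall W X Y Z (f : Hom X Z) (g : Hom Y Z)
    (x : Hom W X) (y : Hom W Y), f ∘ x = g ∘ y -> Hom W (pb f g);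
  pbpair_pr1 : forall W X Y Z (f : Hom X Z) (g : Hom Y Z)
    (x : Hom W X) (y : Hom W Y) (E : f ∘ x = g ∘ y), pr1 f g ∘ pbpair E = x;
  pbpair_pr2 : forall W X Y Z (f : Hom X Z) (g : Hom Y Z)
    (x : Hom W X) (y : Hom W Y) (E : f ∘ x = g ∘ y), pr2 f g ∘ pbpair E = y;
  pb_jm : forall X Y Z (f : Hom X Z) (g : Hom Y Z),
    jointly_monic (pr1 f g) (pr2 f g)
}.

Arguments one {C} _.
Arguments prod {C} _ X Y.
Arguments fst {C} _ {X Y}.
Arguments snd {C} _ {X Y}.
Arguments pair {C} _ {W X Y} x y.
Arguments pb {C} _ {X Y Z} f g.
Arguments pr1 {C} _ {X Y Z} f g.
Arguments pr2 {C} _ {X Y Z} f g.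
Arguments pbpair {C} _ {W X Y Z f g} x y E.

Definition prod_map (C : Category) (L : FinitelyComplete C) (X Y X' Y' : C)
    (f : Hom X X') (g : Hom Y Y') : Hom (prod L X Y) (prod L X' Y') :=
  pair L (f ∘ fst L) (g ∘ snd L).

Lemma prod_is_product (C : Category) (L : FinitelyComplete C) (X Y : C) :
  is_product (@fst C L X Y) (@snd C L X Y).
Proof.
intros W x y; exists (pair L x y); split.
- split; [apply pair_fst | apply pair_snd].
- intros h [h1 h2]; apply (@prod_jm C L X Y).
  + now rewrite pair_fst.
  + now rewrite pair_snd.
Qed.

Lemma pb_is_pullback (C : Category) (L : FinitelyComplete C) (X Y Z : C)
    (f : Hom X Z) (g : Hom Y Z) : is_pullback f g (pr1 L f g) (pr2 L f g).
Proof.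
split; [apply pb_sq|].
intros W x y E; exists (pbpair L x y E); split.
- split; [apply pbpair_pr1 | apply pbpair_pr2].
- intros h [h1 h2]; apply (@pb_jm C L X Y Z f g).
  + now rewrite pbpair_pr1.
  + now rewrite pbpair_pr2.
Qed.

(** * Regular and Barr-exact categories *)

Definition regular (C : Category) (L : FinitelyComplete C) : Prop :=
  (forall (X Y : C) (f : Hom X Y),
     exists (Q : C) (q : Hom X Q), is_coequalizer (pr1 L f f) (pr2 L f f) q) /\
  (forall (X Y Z P : C) (f : Hom X Z) (g : Hom Y Z)
     (p1 : Hom P X) (p2 : Hom P Y),
     is_pullback f g p1 p2 -> regular_epi g -> regular_epi p1).

Definition internal_equivalence (C : Category) (L : FinitelyComplete C)
    (R X : C) (r1 r2 : Hom R X) : Prop :=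
  jointly_monic r1 r2 /\
  (exists e : Hom X R, r1 ∘ e = idm X /\ r2 ∘ e = idm X) /\
  (exists s : Hom R R, r1 ∘ s = r2 /\ r2 ∘ s = r1) /\
  (exists t : Hom (pb L r2 r1) R,
     r1 ∘ t = r1 ∘ pr1 L r2 r1 /\ r2 ∘ t = r2 ∘ pr2 L r2 r1).

(** [(r1, r2)] is the kernel pair of some morphism. *)
Definition effective (C : Category) (R X : C) (r1 r2 : Hom R X) : Prop :=
  exists (Y : C) (f : Hom X Y), is_pullback f f r1 r2.

Definition barr_exact (C : Category) (L : FinitelyComplete C) : Prop :=
  regular L /\
  forall (R X : C) (r1 r2 : Hom R X),
    internal_equivalence L r1 r2 -> effective r1 r2.

(** * Internal groupoids

    Composition is in diagrammatic order: a generalized element of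
    [pb L cod dom] is a pair [(f, g)] with [cod ∘ f = dom ∘ g], and
    [m (f, g)] goes from [dom ∘ f] to [cod ∘ g]. *)

(** The commutations below are those under which the pairings in the axioms of
    internal groupoids and functors exist. *)
Section Commutations.
Variables (C : Category) (L : FinitelyComplete C).
Variables (H0 H1 : C) (d c : Hom H1 H0) (e : Hom H0 H1)
  (m : Hom (pb L c d) H1) (i : Hom H1 H1).

Lemma unitl_comm (ce : c ∘ e = idm H0) : c ∘ (e ∘ d) = d ∘ idm H1.
Proof. now rewrite comp_assoc, ce, comp_idl, comp_idr. Qed.

Lemma unitr_comm (de : d ∘ e = idm H0) : c ∘ idm H1 = d ∘ (e ∘ c).
Proof. now rewrite comp_assoc, de, comp_idl, comp_idr. Qed.

Lemma invr_comm (di : d ∘ i = c) : c ∘ idm H1 = d ∘ i.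
Proof. now rewrite di, comp_idr. Qed.

Lemma invl_comm (ci : c ∘ i = d) : c ∘ i = d ∘ idm H1.
Proof. now rewrite ci, comp_idr. Qed.

Lemma assocl_comm (cm : c ∘ m = c ∘ pr2 L c d) (X : C) (f g h : Hom X H1)
    (fg : c ∘ f = d ∘ g) (gh : c ∘ g = d ∘ h) :
  c ∘ (m ∘ pbpair L f g fg) = d ∘ h.
Proof. now rewrite comp_assoc, cm, <- comp_assoc, pbpair_pr2. Qed.

Lemma assocr_comm (dm : d ∘ m = d ∘ pr1 L c d) (X : C) (f g h : Hom X H1)
    (fg : c ∘ f = d ∘ g) (gh : c ∘ g = d ∘ h) :
  c ∘ f = d ∘ (m ∘ pbpair L g h gh).
Proof. now rewrite comp_assoc, dm, <- comp_assoc, pbpair_pr1. Qed.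

Variables (G0 G1 : C) (d' c' : Hom G1 G0).
Variables (f0 : Hom H0 G0) (f1 : Hom H1 G1).

Lemma functor_comm (fd : d' ∘ f1 = f0 ∘ d) (fc : c' ∘ f1 = f0 ∘ c) :
  c' ∘ (f1 ∘ pr1 L c d) = d' ∘ (f1 ∘ pr2 L c d).
Proof. now rewrite !comp_assoc, fd, fc, <- !comp_assoc, pb_sq. Qed.

End Commutations.

Record Groupoid (C : Category) (L : FinitelyComplete C) : Type := {
  obj : C;
  arr : C;
  dom : Hom arr obj;
  cod : Hom arr obj;
  ide : Hom obj arr;
  mul : Hom (pb L cod dom) arr;
  inv : Hom arr arr;
  dom_ide : dom ∘ ide = idm obj;
  cod_ide : cod ∘ ide = idm obj;
  dom_mul : dom ∘ mul = dom ∘ pr1 L cod dom;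
  cod_mul : cod ∘ mul = cod ∘ pr2 L cod dom;
  dom_inv : dom ∘ inv = cod;
  cod_inv : cod ∘ inv = dom;
  mul_unitl :
    mul ∘ pbpair L (ide ∘ dom) (idm arr) (unitl_comm dom cod_ide) = idm arr;
  mul_unitr :
    mul ∘ pbpair L (idm arr) (ide ∘ cod) (unitr_comm cod dom_ide) = idm arr;
  mul_assoc : forall (X : C) (f g h : Hom X arr)
    (fg : cod ∘ f = dom ∘ g) (gh : cod ∘ g = dom ∘ h),
    mul ∘ pbpair L (mul ∘ pbpair L f g fg) h (assocl_comm cod_mul fg gh) =
    mul ∘ pbpair L f (mul ∘ pbpair L g h gh) (assocr_comm dom_mul fg gh);
  mul_invr : mul ∘ pbpair L (idm arr) inv (invr_comm dom_inv) = ide ∘ dom;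
  mul_invl : mul ∘ pbpair L inv (idm arr) (invl_comm cod_inv) = ide ∘ cod
}.

Arguments dom {C L} _.
Arguments cod {C L} _.
Arguments ide {C L} _.
Arguments mul {C L} _.
Arguments inv {C L} _.

Record Functor (C : Category) (L : FinitelyComplete C) (H G : Groupoid L)
    : Type := {
  f0 : Hom (obj H) (obj G);
  f1 : Hom (arr H) (arr G);
  f_dom : dom G ∘ f1 = f0 ∘ dom H;
  f_cod : cod G ∘ f1 = f0 ∘ cod H;
  f_ide : f1 ∘ ide H = ide G ∘ f0;
  f_mul : f1 ∘ mul H =
    mul G ∘ pbpair L (f1 ∘ pr1 L (cod H) (dom H)) (f1 ∘ pr2 L (cod H) (dom H))
              (functor_comm L f_dom f_cod)
}.

Lemma functor_ext (C : Category) (L : FinitelyComplete C) (H G : Groupoid L)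
    (F F' : Functor H G) : f0 F = f0 F' -> f1 F = f1 F' -> F = F'.
Proof.
destruct F as [a0 a1 p q r s], F' as [b0 b1 p' q' r' s']; simpl.
intros E0 E1; subst b0 b1.
assert (p = p') by apply proof_irrelevance; subst p'.
assert (q = q') by apply proof_irrelevance; subst q'.
f_equal; apply proof_irrelevance.
Qed.

Definition functor_id (C : Category) (L : FinitelyComplete C)
    (H : Groupoid L) : Functor H H.
Proof.
unshelve refine {| f0 := idm (obj H); f1 := idm (arr H) |}.
- abstract (now rewrite comp_idl, comp_idr).
- abstract (now rewrite comp_idl, comp_idr).
- abstract (now rewrite comp_idl, comp_idr).
- transitivity (mul H ∘ idm _);
    [now rewrite (comp_idl (mul H)), comp_idr | f_equal].
  apply (@pb_jm C L _ _ _ (cod H) (dom H)).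
  + now rewrite pbpair_pr1, comp_idl, comp_idr.
  + now rewrite pbpair_pr2, comp_idl, comp_idr.
Defined.

Definition functor_comp (C : Category) (L : FinitelyComplete C)
    (H G K : Groupoid L) (B : Functor G K) (A : Functor H G) : Functor H K.
Proof.
unshelve refine {| f0 := f0 B ∘ f0 A; f1 := f1 B ∘ f1 A |}.
- abstract (now rewrite comp_assoc, f_dom, <- comp_assoc, f_dom, comp_assoc).
- abstract (now rewrite comp_assoc, f_cod, <- comp_assoc, f_cod, comp_assoc).
- abstract (now rewrite <- comp_assoc, f_ide, comp_assoc, f_ide, comp_assoc).
- rewrite <- comp_assoc, f_mul, comp_assoc, f_mul, <- comp_assoc; f_equal.
  apply (@pb_jm C L _ _ _ (cod K) (dom K)).
  + now rewrite comp_assoc, !pbpair_pr1, <- comp_assoc, pbpair_pr1, comp_assoc.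
  + now rewrite comp_assoc, !pbpair_pr2, <- comp_assoc, pbpair_pr2, comp_assoc.
Defined.

Definition Gpd (C : Category) (L : FinitelyComplete C) : Category.
Proof.
refine {| Ob := Groupoid L; Hom := @Functor C L;
          idm := @functor_id C L; comp := @functor_comp C L |}.
- intros; apply functor_ext; apply comp_idl.
- intros; apply functor_ext; apply comp_idr.
- intros; apply functor_ext; apply comp_assoc.
Defined.

(** * Properties of internal functors *)

Definition discrete_fibration (C : Category) (L : FinitelyComplete C)
    (H G : Groupoid L) (F : Functor H G) : Prop :=
  is_pullback (f0 F) (cod G) (cod H) (f1 F).

Definition final (C : Category) (L : FinitelyComplete C)
    (H G : Groupoid L) (F : Functor H G) : Prop :=
  forall (A B : Groupoid L) (K : Functor A B),
    discrete_fibration K -> @orthogonal (Gpd L) H G A B F K.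

Definition domcod (C : Category) (L : FinitelyComplete C) (G : Groupoid L) :
    Hom (arr G) (prod L (obj G) (obj G)) :=
  pair L (dom G) (cod G).

Lemma phi_comm (C : Category) (L : FinitelyComplete C)
    (H G : Groupoid L) (F : Functor H G) :
  prod_map L (f0 F) (f0 F) ∘ domcod H = domcod G ∘ f1 F.
Proof.
apply (@prod_jm C L); unfold prod_map, domcod; rewrite !comp_assoc.
- now rewrite !pair_fst, <- comp_assoc, pair_fst, f_dom.
- now rewrite !pair_snd, <- comp_assoc, pair_snd, f_cod.
Qed.

Definition phi (C : Category) (L : FinitelyComplete C)
    (H G : Groupoid L) (F : Functor H G) :
    Hom (arr H) (pb L (prod_map L (f0 F) (f0 F)) (domcod G)) :=
  pbpair L (domcod H) (f1 F) (phi_comm F).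

Definition full (C : Category) (L : FinitelyComplete C)
    (H G : Groupoid L) (F : Functor H G) : Prop :=
  regular_epi (phi F).

Definition essentially_surjective (C : Category) (L : FinitelyComplete C)
    (H G : Groupoid L) (F : Functor H G) : Prop :=
  regular_epi (cod G ∘ pr2 L (f0 F) (dom G)).

(* Main.v *)
(* Generalized elements make every internal groupoid an ordinary one, and regular
   epimorphisms play the role of covers.  Let [E0] be the comma object of pairs
   [(h, g : F h -> y)].

   If [F] is full and essentially surjective, a lifting problem against a
   discrete fibration [K] is solved on [E0] by lifting [V g^-1] along [K] to an
   arrow ending at [U h]; by fullness the domain of the lift depends only on [y],
   so it descends along the cover [E0 -> G0].

   Conversely, identify [(h, F v * g')] with [(h', g')] for [v : h -> h'].  By
   exactness the quotient [Q] of [E0] is effective; [G] acts on it, and the action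
   groupoid is a discrete fibration over [G] through which [F] factors.  Finality
   yields a section [D] of it under [H].  As [D0] lifts locally to [E0], [F] is
   essentially surjective; and [D] applied to [g : F a -> F b] identifies
   [(a, 1)] with [(b, g^-1)], so that [g] is locally in the image of [F]. *)

From Stdlib Require Import ClassicalEpsilon.
Require Import Defs.

Set Implicit Arguments.
Unset Strict Implicit.
Unset Printing Implicit Defensive.

(** * Generalized elements *)

Lemma comp_reassoc (C : Category) (W X Y Z : C)
    (h : Hom Y Z) (g : Hom X Y) (f : Hom W X) : h ∘ g ∘ f = h ∘ (g ∘ f).
Proof. symmetry; apply comp_assoc. Qed.

(** Normal forms associate composites to the right, so every equation is also needed with an
    arbitrary element behind it; this produces those versions. *)
Lemma comp_eq_l (C : Category) (X Y Z : C) (h : Hom X Z) (g : Hom Y Z)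
    (f : Hom X Y) (E : g ∘ f = h) (W : C) (x : Hom W X) :
  g ∘ (f ∘ x) = h ∘ x.
Proof. now rewrite comp_assoc, E. Qed.

Section GeneralizedElements.
Variables (C : Category) (L : FinitelyComplete C).

Lemma pbpair_pr1_l (V W X Y Z : C) (f : Hom X Z) (g : Hom Y Z)
    (x : Hom W X) (y : Hom W Y) (E : f ∘ x = g ∘ y) (w : Hom V W) :
  pr1 L f g ∘ (pbpair L x y E ∘ w) = x ∘ w.
Proof. apply comp_eq_l, pbpair_pr1. Qed.

Lemma pbpair_pr2_l (V W X Y Z : C) (f : Hom X Z) (g : Hom Y Z)
    (x : Hom W X) (y : Hom W Y) (E : f ∘ x = g ∘ y) (w : Hom V W) :
  pr2 L f g ∘ (pbpair L x y E ∘ w) = y ∘ w.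
Proof. apply comp_eq_l, pbpair_pr2. Qed.

Lemma pb_sq_l (W X Y Z : C) (f : Hom X Z) (g : Hom Y Z) (w : Hom W (pb L f g)) :
  f ∘ (pr1 L f g ∘ w) = g ∘ (pr2 L f g ∘ w).
Proof. now rewrite !comp_assoc, pb_sq. Qed.

Lemma pair_fst_l (V W X Y : C) (x : Hom W X) (y : Hom W Y) (w : Hom V W) :
  fst L ∘ (pair L x y ∘ w) = x ∘ w.
Proof. apply comp_eq_l, pair_fst. Qed.

Lemma pair_snd_l (V W X Y : C) (x : Hom W X) (y : Hom W Y) (w : Hom V W) :
  snd L ∘ (pair L x y ∘ w) = y ∘ w.
Proof. apply comp_eq_l, pair_snd. Qed.

Lemma dom_ide_l (G : Groupoid L) (W : C) (x : Hom W (obj G)) :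
  dom G ∘ (ide G ∘ x) = x.
Proof. rewrite (comp_eq_l (dom_ide G)); apply comp_idl. Qed.

Lemma cod_ide_l (G : Groupoid L) (W : C) (x : Hom W (obj G)) :
  cod G ∘ (ide G ∘ x) = x.
Proof. rewrite (comp_eq_l (cod_ide G)); apply comp_idl. Qed.

Lemma dom_inv_l (G : Groupoid L) (W : C) (x : Hom W (arr G)) :
  dom G ∘ (inv G ∘ x) = cod G ∘ x.
Proof. apply comp_eq_l, dom_inv. Qed.

Lemma cod_inv_l (G : Groupoid L) (W : C) (x : Hom W (arr G)) :
  cod G ∘ (inv G ∘ x) = dom G ∘ x.
Proof. apply comp_eq_l, cod_inv. Qed.

Lemma f_dom_l (H G : Groupoid L) (F : Functor H G) (W : C)
    (x : Hom W (arr H)) : dom G ∘ (f1 F ∘ x) = f0 F ∘ (dom H ∘ x).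
Proof. rewrite (comp_eq_l (f_dom F)); apply comp_reassoc. Qed.

Lemma f_cod_l (H G : Groupoid L) (F : Functor H G) (W : C)
    (x : Hom W (arr H)) : cod G ∘ (f1 F ∘ x) = f0 F ∘ (cod H ∘ x).
Proof. rewrite (comp_eq_l (f_cod F)); apply comp_reassoc. Qed.

Lemma f_ide_l (H G : Groupoid L) (F : Functor H G) (W : C)
    (x : Hom W (obj H)) : f1 F ∘ (ide H ∘ x) = ide G ∘ (f0 F ∘ x).
Proof. rewrite (comp_eq_l (f_ide F)); apply comp_reassoc. Qed.

Lemma comma_dom (H G : Groupoid L) (F : Functor H G) (W : C)
    (x : Hom W (pb L (f0 F) (dom G))) :
  dom G ∘ (pr2 L (f0 F) (dom G) ∘ x) = f0 F ∘ (pr1 L (f0 F) (dom G) ∘ x).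
Proof. symmetry; apply pb_sq_l. Qed.

End GeneralizedElements.

#[local] Hint Rewrite comp_reassoc comp_idl comp_idr
  pbpair_pr1 pbpair_pr2 pbpair_pr1_l pbpair_pr2_l
  pair_fst pair_snd pair_fst_l pair_snd_l
  dom_ide cod_ide dom_inv cod_inv f_dom f_cod f_ide
  dom_ide_l cod_ide_l dom_inv_l cod_inv_l f_dom_l f_cod_l f_ide_l : cat.

Ltac cat := autorewrite with cat.
Tactic Notation "cat" "in" hyp(E) := autorewrite with cat in E.

(** * Composition of generalized arrows *)

Section Mulg.
Variables (C : Category) (L : FinitelyComplete C).

(* Totalised by the junk value [f] on non-composable pairs, so that rewriting
   inside [f] and [g] is not obstructed by a proof of composability. *)
Definition mulg (G : Groupoid L) (W : C) (f g : Hom W (arr G)) :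
    Hom W (arr G) :=
  match excluded_middle_informative (cod G ∘ f = dom G ∘ g) with
  | left E => mul G ∘ pbpair L f g E
  | right _ => f
  end.

Lemma mulgE (G : Groupoid L) (W : C) (f g : Hom W (arr G))
    (E : cod G ∘ f = dom G ∘ g) :
  mul G ∘ pbpair L f g E = mulg f g.
Proof.
unfold mulg; destruct excluded_middle_informative as [E'|N].
- now rewrite (ProofIrrelevance.proof_irrelevance _ E E').
- contradiction.
Qed.

Lemma mulE (G : Groupoid L) :
  mul G = mulg (pr1 L (cod G) (dom G)) (pr2 L (cod G) (dom G)).
Proof.
rewrite <- (mulgE (pb_sq L (cod G) (dom G))), <- (comp_idr (mul G)) at 1.
f_equal; apply (@pb_jm C L _ _ _ (cod G) (dom G)); now cat.
Qed.

(** Composability is required before restriction along [w]: a pair that is not composable could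
    become so after it, and the junk value would not be respected. *)
Lemma mulg_comp (G : Groupoid L) (V W : C) (f g : Hom W (arr G))
    (w : Hom V W) :
  cod G ∘ f = dom G ∘ g -> mulg f g ∘ w = mulg (f ∘ w) (g ∘ w).
Proof.
intro E.
assert (E' : cod G ∘ (f ∘ w) = dom G ∘ (g ∘ w)) by now rewrite !comp_assoc, E.
rewrite <- (mulgE E), <- (mulgE E'), comp_reassoc; f_equal.
apply (@pb_jm C L _ _ _ (cod G) (dom G)); now cat.
Qed.

Section Laws.
Variables (G : Groupoid L) (W : C).
Implicit Types f g h : Hom W (arr G).

Lemma dom_mulg f g : cod G ∘ f = dom G ∘ g -> dom G ∘ mulg f g = dom G ∘ f.
Proof.
intro E; rewrite <- (mulgE E), (comp_eq_l (dom_mul G)); now cat.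
Qed.

Lemma cod_mulg f g : cod G ∘ f = dom G ∘ g -> cod G ∘ mulg f g = cod G ∘ g.
Proof.
intro E; rewrite <- (mulgE E), (comp_eq_l (cod_mul G)); now cat.
Qed.

Lemma mulg_assoc f g h :
  cod G ∘ f = dom G ∘ g -> cod G ∘ g = dom G ∘ h ->
  mulg (mulg f g) h = mulg f (mulg g h).
Proof.
intros E1 E2; pose proof (mul_assoc E1 E2) as A; revert A.
(* The composability proofs mention the inner composites, so they are generalized before these are
   rewritten to [mulg]. *)
generalize (assocl_comm (cod_mul G) E1 E2) (assocr_comm (dom_mul G) E1 E2).
rewrite (mulgE E1), (mulgE E2); intros E3 E4.
now rewrite (mulgE E3), (mulgE E4).
Qed.

(** The internal axiom is evaluated at the element [f]. The object [a] is tied to the domain only by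
    an equation, so that the law applies however the domain is written. *)
Lemma mulg_idl f (a : Hom W (obj G)) : a = dom G ∘ f -> mulg (ide G ∘ a) f = f.
Proof.
intros ->; generalize (f_equal (fun k => k ∘ f) (mul_unitl G)); cbv beta.
rewrite mulgE, mulg_comp by apply unitl_comm, cod_ide; now cat.
Qed.

Lemma mulg_idr f (a : Hom W (obj G)) : a = cod G ∘ f -> mulg f (ide G ∘ a) = f.
Proof.
intros ->; generalize (f_equal (fun k => k ∘ f) (mul_unitr G)); cbv beta.
rewrite mulgE, mulg_comp by apply unitr_comm, dom_ide; now cat.
Qed.

Lemma mulgV f : mulg f (inv G ∘ f) = ide G ∘ (dom G ∘ f).
Proof.
generalize (f_equal (fun k => k ∘ f) (mul_invr G)); cbv beta.
rewrite mulgE, mulg_comp by apply invr_comm, dom_inv; now cat.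
Qed.

Lemma mulVg f : mulg (inv G ∘ f) f = ide G ∘ (cod G ∘ f).
Proof.
generalize (f_equal (fun k => k ∘ f) (mul_invl G)); cbv beta.
rewrite mulgE, mulg_comp by apply invl_comm, cod_inv; now cat.
Qed.

Lemma mulgK f g : cod G ∘ f = dom G ∘ g -> mulg (mulg f g) (inv G ∘ g) = f.
Proof.
intro E; rewrite mulg_assoc by now cat.
now rewrite mulgV; apply mulg_idr.
Qed.

Lemma mulKg f g : cod G ∘ f = dom G ∘ g -> mulg (inv G ∘ f) (mulg f g) = g.
Proof.
intro E; rewrite <- mulg_assoc by now cat.
now rewrite mulVg; apply mulg_idl.
Qed.

(** This is the tool for computing inverses: two candidates agree once they have the same product
    with one arrow. *)
Lemma mulg_injr f g h :
  cod G ∘ f = dom G ∘ h -> cod G ∘ g = dom G ∘ h ->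
  mulg f h = mulg g h -> f = g.
Proof. intros Ef Eg E; now rewrite <- (mulgK Ef), E, mulgK. Qed.

Lemma inv_ide (a : Hom W (obj G)) : inv G ∘ (ide G ∘ a) = ide G ∘ a.
Proof.
apply mulg_injr with (h := ide G ∘ a); cat; auto.
now rewrite mulVg, mulg_idl; cat.
Qed.

Lemma inv_mulg f g :
  cod G ∘ f = dom G ∘ g -> inv G ∘ mulg f g = mulg (inv G ∘ g) (inv G ∘ f).
Proof.
intro E; assert (E' : cod G ∘ (inv G ∘ g) = dom G ∘ (inv G ∘ f)) by now cat.
apply mulg_injr with (h := mulg f g);
  rewrite ?cod_mulg, ?dom_mulg by (cat; auto); cat; rewrite ?dom_mulg; auto.
rewrite mulVg, mulg_assoc, mulKg by (cat; rewrite ?dom_mulg; auto).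
now rewrite cod_mulg, mulVg.
Qed.

End Laws.

Lemma functor_mulg (H G : Groupoid L) (F : Functor H G) (W : C)
    (f g : Hom W (arr H)) (E : cod H ∘ f = dom H ∘ g) :
  f1 F ∘ mulg f g = mulg (f1 F ∘ f) (f1 F ∘ g).
Proof.
rewrite <- (mulgE E), comp_assoc, f_mul, mulgE, mulg_comp.
- now cat.
- exact (functor_comm L (f_dom F) (f_cod F)).
Qed.

(** Preservation of inverses is not a field of [Functor]; it follows by cancelling [F f] on the
    right. *)
Lemma functor_inv (H G : Groupoid L) (F : Functor H G) (W : C)
    (f : Hom W (arr H)) :
  f1 F ∘ (inv H ∘ f) = inv G ∘ (f1 F ∘ f).
Proof.
apply mulg_injr with (h := f1 F ∘ f); cat; auto.
rewrite mulVg, <- functor_mulg, mulVg; now cat.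
Qed.

End Mulg.

(** * Regular epimorphisms in a regular category *)

Section Covers.
Variables (C : Category) (L : FinitelyComplete C).

Definition monic (X Y : C) (m : Hom X Y) : Prop :=
  forall (W : C) (a b : Hom W X), m ∘ a = m ∘ b -> a = b.

Lemma regular_epi_epi (X Q : C) (q : Hom X Q) : regular_epi q ->
  forall (W : C) (a b : Hom Q W), a ∘ q = b ∘ q -> a = b.
Proof.
intros (R & u & v & E & D) W a b Eab.
destruct (D W (a ∘ q)) as (h & _ & U).
- now rewrite !comp_reassoc, E.
- rewrite <- (U a), <- (U b); auto.
Qed.

(** The condition on [x], imposed on all pairs that [q] identifies, holds in particular for the pair
    whose coequalizer is [q]. *)
Lemma regular_epi_descent (X Q W : C) (q : Hom X Q) (x : Hom X W) :
  regular_epi q ->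
  (forall (V : C) (a b : Hom V X), q ∘ a = q ∘ b -> x ∘ a = x ∘ b) ->
  exists h : Hom Q W, h ∘ q = x.
Proof.
intros (R & u & v & E & D) Ex.
destruct (D W x (Ex _ _ _ E)) as (h & Eh & _); eauto.
Qed.

Lemma regular_epi_idm (X : C) : regular_epi (idm X).
Proof.
exists X, (idm X), (idm X); split; [reflexivity|].
intros W x _; exists x; split; [apply comp_idr|].
intros k Ek; now rewrite comp_idr in Ek.
Qed.

Hypothesis hC : regular L.

Lemma regular_epi_pullback (X Y Z : C) (f : Hom X Z) (g : Hom Y Z) :
  regular_epi g -> regular_epi (pr1 L f g).
Proof. exact (proj2 hC _ _ _ _ _ _ _ _ (pb_is_pullback L f g)). Qed.

(** Covers behave like surjections: an element [y] acquires a preimage after passing to a cover [p]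
    of its stage, obtained by pulling [q] back. *)
Lemma regular_epi_local (X Y W : C) (q : Hom X Y) (y : Hom W Y) :
  regular_epi q ->
  exists (V : C) (p : Hom V W) (x : Hom V X), regular_epi p /\ q ∘ x = y ∘ p.
Proof.
intro Hq; exists (pb L y q), (pr1 L y q), (pr2 L y q); split.
- now apply regular_epi_pullback.
- symmetry; apply pb_sq.
Qed.

Lemma image_factorization (X Y : C) (f : Hom X Y) :
  exists (I : C) (e : Hom X I) (m : Hom I Y),
    regular_epi e /\ monic m /\ m ∘ e = f.
Proof.
destruct (proj1 hC X Y f) as (I & e & He).
assert (Re : regular_epi e) by (do 3 eexists; exact He).
destruct He as [E D]; destruct (D Y f (pb_sq L f f)) as (m & Em & _).
exists I, e, m; repeat split; auto.
intros W a b Eab.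
(* After two successive covers [a] and [b] lift along [e]. The lifts agree under [f], so they form
   an element of its kernel pair, which [e] coequalizes. *)
destruct (regular_epi_local a Re) as (V & p & x & Rp & Ex).
destruct (regular_epi_local (b ∘ p) Re) as (V' & p' & y & Rp' & Ey).
apply (regular_epi_epi Rp), (regular_epi_epi Rp').
rewrite <- Ey, <- Ex, comp_reassoc.
assert (Ef : f ∘ (x ∘ p') = f ∘ y).
{ rewrite <- Em, !comp_reassoc, Ey, (comp_eq_l Ex), !comp_reassoc.
  now rewrite !(comp_eq_l Eab), comp_reassoc. }
generalize (f_equal (fun k => k ∘ pbpair L _ _ Ef) E); now cat.
Qed.

(** A monomorphism with a section is invertible, so [m ∘ e] is [e] up to an isomorphism of its
    target. *)
Lemma regular_epi_image_split (X I Y : C) (e : Hom X I) (m : Hom I Y)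
    (s : Hom Y I) :
  regular_epi e -> monic m -> m ∘ s = idm Y -> regular_epi (m ∘ e).
Proof.
intros He Hm Ems.
assert (Esm : s ∘ m = idm I).
{ apply Hm; now rewrite comp_assoc, Ems, comp_idl, comp_idr. }
pose proof (regular_epi_epi He) as epi.
destruct He as (R & u & v & E & D); exists R, u, v; split.
- now rewrite !comp_reassoc, E.
- intros W x Ex; destruct (D W x Ex) as (h & Eh & _).
  exists (h ∘ s); split.
  + now rewrite comp_reassoc, (comp_assoc s), Esm, comp_idl.
  + intros k Ek; rewrite <- (comp_idr k), <- Ems, comp_assoc; f_equal.
    apply epi; now rewrite Eh, comp_reassoc.
Qed.

(** In the image factorization of [q], the map [e ∘ t] descends along [q ∘ t] to a section of the
    monomorphism [m]. *)
Lemma regular_epi_cancel (X Y Z : C) (q : Hom Y Z) (t : Hom X Y) :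
  regular_epi (q ∘ t) -> regular_epi q.
Proof.
intro Hp; destruct (image_factorization q) as (I & e & m & He & Hm & Em).
destruct (regular_epi_descent (x := e ∘ t) Hp) as (s & Es).
{ intros V a b E; apply Hm; now rewrite !comp_assoc, Em. }
rewrite <- Em; apply regular_epi_image_split with (s := s); auto.
apply (regular_epi_epi Hp).
now rewrite comp_reassoc, Es, comp_assoc, Em, comp_idl.
Qed.

(** The regular epimorphism onto the image of [q ∘ p] descends first along [p], then along [q], to a
    section of the monomorphic part. *)
Lemma regular_epi_comp (X Y Z : C) (q : Hom Y Z) (p : Hom X Y) :
  regular_epi q -> regular_epi p -> regular_epi (q ∘ p).
Proof.
intros Hq Hp.
destruct (image_factorization (q ∘ p)) as (I & e & m & He & Hm & Em).
destruct (regular_epi_descent (x := e) Hp) as (e' & Ee').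
{ intros V a b E; apply Hm; now rewrite !comp_assoc, Em, !comp_reassoc, E. }
assert (Em' : m ∘ e' = q).
{ apply (regular_epi_epi Hp); now rewrite comp_reassoc, Ee'. }
destruct (regular_epi_descent (x := e') Hq) as (s & Es).
{ intros V a b E; apply Hm; now rewrite !comp_assoc, Em'. }
rewrite <- Em; apply regular_epi_image_split with (s := s); auto.
apply (regular_epi_epi Hq).
now rewrite comp_reassoc, Es, Em', comp_idl.
Qed.

(** Local sections suffice for a cover; both fullness and essential surjectivity are verified
    through this criterion. *)
Lemma regular_epi_of_local (X Y : C) (q : Hom X Y) :
  (exists (V : C) (p : Hom V Y) (x : Hom V X), regular_epi p /\ q ∘ x = p) ->
  regular_epi q.
Proof.
intros (V & p & x & Hp & E); apply regular_epi_cancel with (t := x).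
now rewrite E.
Qed.

(** Membership in a relation may be checked on a cover: joint monicity makes local witnesses unique,
    so they descend. *)
Lemma jointly_monic_local (R X Y V W : C) (r1 : Hom R X) (r2 : Hom R Y)
    (x : Hom W X) (y : Hom W Y) (p : Hom V W) (r : Hom V R) :
  jointly_monic r1 r2 -> regular_epi p -> r1 ∘ r = x ∘ p -> r2 ∘ r = y ∘ p ->
  exists s : Hom W R, r1 ∘ s = x /\ r2 ∘ s = y.
Proof.
intros J Hp E1 E2; destruct (regular_epi_descent (x := r) Hp) as (s & Es).
{ intros T a b E; apply J; rewrite !comp_assoc, ?E1, ?E2.
  - now rewrite !comp_reassoc, E.
  - now rewrite !comp_reassoc, E. }
exists s; split; apply (regular_epi_epi Hp); now rewrite comp_reassoc, Es.
Qed.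

End Covers.

(** * Effective quotients of locally defined equivalence relations *)

Section ExactQuotient.
Variables (C : Category) (L : FinitelyComplete C) (hC : barr_exact L).
Variables (S X : C) (s1 s2 : Hom S X).

(** The span [(s1, s2)] need not be jointly monic; this describes the elements of its image in
    [X × X]. *)
Definition locally_related (W : C) (x y : Hom W X) : Prop :=
  exists (V : C) (p : Hom V W) (s : Hom V S),
    regular_epi p /\ s1 ∘ s = x ∘ p /\ s2 ∘ s = y ∘ p.

Hypothesis rel_refl : forall W (x : Hom W X), locally_related x x.
Hypothesis rel_sym : forall W (x y : Hom W X),
  locally_related x y -> locally_related y x.
Hypothesis rel_trans : forall W (x y z : Hom W X),
  locally_related x y -> locally_related y z -> locally_related x z.

Lemma exact_quotient : exists (Q : C) (k : Hom X Q), regular_epi k /\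
  forall (W : C) (x y : Hom W X), k ∘ x = k ∘ y <-> locally_related x y.
Proof.
pose proof (proj1 hC) as hR.
destruct (image_factorization hR (pair L s1 s2)) as (R & e & m & He & Hm & Em).
set (r1 := fst L ∘ m); set (r2 := snd L ∘ m).
assert (Er1 : r1 ∘ e = s1) by (unfold r1; now rewrite comp_reassoc, Em; cat).
assert (Er2 : r2 ∘ e = s2) by (unfold r2; now rewrite comp_reassoc, Em; cat).
assert (J : jointly_monic r1 r2).
{ intros W a b E1 E2; apply Hm, (@prod_jm C L); now rewrite !comp_assoc. }
(* The elements of the image [R] are exactly the locally related pairs, so the three hypotheses turn
   into the axioms of an internal equivalence relation. *)
assert (HR : forall (W : C) (x y : Hom W X), locally_related x y <->
  exists r : Hom W R, r1 ∘ r = x /\ r2 ∘ r = y).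
{ intros W x y; split.
  - intros (V & p & s & Hp & E1 & E2).
    apply (@jointly_monic_local C R X X V W r1 r2 x y p (e ∘ s)); auto.
    + now rewrite comp_assoc, Er1.
    + now rewrite comp_assoc, Er2.
  - intros (r & <- & <-).
    destruct (regular_epi_local hR r He) as (V & p & s & Hp & Es).
    exists V, p, s; split; [exact Hp|].
    now rewrite <- Er1, <- Er2, !comp_reassoc, Es. }
destruct (proj2 hC R X r1 r2) as (Y & f & Ef & Uf).
{ split; [exact J|]; repeat split.
  - apply HR, rel_refl.
  - apply HR, rel_sym, HR; exists (idm R); now rewrite !comp_idr.
  - apply HR, rel_trans with (r2 ∘ pr1 L r2 r1); apply HR; eauto.
    exists (pr2 L r2 r1); now rewrite pb_sq. }
(* Exactness gives only some [f] with kernel pair [R]. Its regular epimorphic part [k] has the same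
   kernel pair, as [n] is monic. *)
destruct (image_factorization hR f) as (Q & k & n & Hk & Hn & En).
exists Q, k; split; [exact Hk|].
intros W x y; rewrite HR; split.
- intro E; destruct (Uf W x y) as (r & Er & _); [|eauto].
  now rewrite <- En, !comp_reassoc, E.
- intros (r & <- & <-); apply Hn.
  now rewrite !comp_assoc, En, Ef.
Qed.

End ExactQuotient.

(** * Discrete fibrations *)

Section DiscreteFibrations.
Variables (C : Category) (L : FinitelyComplete C).

Section Lifting.
Variables (A B : Groupoid L) (K : Functor A B).
Hypothesis hK : discrete_fibration K.

Lemma discrete_fibration_lift (W : C) (a : Hom W (obj A)) (b : Hom W (arr B)) :
  f0 K ∘ a = cod B ∘ b ->
  exists l : Hom W (arr A), cod A ∘ l = a /\ f1 K ∘ l = b.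
Proof.
intro E; destruct (proj2 hK W a b E) as (l & El & _); eauto.
Qed.

Lemma discrete_fibration_inj (W : C) (l l' : Hom W (arr A)) :
  cod A ∘ l = cod A ∘ l' -> f1 K ∘ l = f1 K ∘ l' -> l = l'.
Proof.
intros E0 E1.
destruct (proj2 hK W (cod A ∘ l) (f1 K ∘ l)) as (k & _ & U).
- rewrite !comp_assoc; f_equal; apply hK.
- rewrite <- (U l), <- (U l'); auto.
Qed.

(** Preservation of identities and composition is automatic over [V]: in each equation both sides
    are lifts of the same arrow with the same codomain. *)
Lemma functor_over (G : Groupoid L) (V : Functor G B)
    (D0 : Hom (obj G) (obj A)) (D1 : Hom (arr G) (arr A)) :
  dom A ∘ D1 = D0 ∘ dom G -> cod A ∘ D1 = D0 ∘ cod G ->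
  f0 K ∘ D0 = f0 V -> f1 K ∘ D1 = f1 V ->
  exists D : Functor G A, f0 D = D0 /\ f1 D = D1.
Proof.
intros Ed Ec E0 E1.
assert (Ei : D1 ∘ ide G = ide A ∘ D0).
{ apply discrete_fibration_inj; rewrite ?(comp_eq_l Ec), ?(comp_eq_l E1); cat.
  - reflexivity.
  - now rewrite E0. }
assert (Em : D1 ∘ mul G = mul A ∘ pbpair L _ _ (functor_comm L Ed Ec)).
{ pose proof (functor_comm L Ed Ec) as Ep.
  rewrite mulE, mulgE; apply discrete_fibration_inj.
  - rewrite cod_mulg, !(comp_eq_l Ec) by exact Ep; cat.
    now rewrite cod_mulg by apply pb_sq.
  - rewrite functor_mulg, !(comp_eq_l E1) by exact Ep.
    now rewrite functor_mulg by apply pb_sq. }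
now exists {| f0 := D0; f1 := D1; f_dom := Ed; f_cod := Ec; f_ide := Ei;
          f_mul := Em |}.
Qed.

End Lifting.

(** * Full and essentially surjective functors are final *)

Section FullEssSurjFinal.
Hypothesis hC : regular L.
Variables (H G A B : Groupoid L) (F : Functor H G) (K : Functor A B).
Hypotheses (hfull : full F) (hsurj : essentially_surjective F).
Hypothesis hK : discrete_fibration K.

Lemma full_local (W : C) (x y : Hom W (obj H)) (g : Hom W (arr G)) :
  dom G ∘ g = f0 F ∘ x -> cod G ∘ g = f0 F ∘ y ->
  exists (V : C) (p : Hom V W) (w : Hom V (arr H)), regular_epi p /\
    dom H ∘ w = x ∘ p /\ cod H ∘ w = y ∘ p /\ f1 F ∘ w = g ∘ p.
Proof.
intros Ed Ec.
assert (E : prod_map L (f0 F) (f0 F) ∘ pair L x y = domcod G ∘ g).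
{ apply (@prod_jm C L); unfold prod_map, domcod; cat; auto. }
destruct (regular_epi_local hC (pbpair L _ _ E) hfull)
  as (V & p & w & Hp & Ew).
exists V, p, w; split; [exact Hp|].
unfold phi, domcod in Ew.
repeat split.
- generalize (f_equal (fun k => fst L ∘ (pr1 L _ _ ∘ k)) Ew); now cat.
- generalize (f_equal (fun k => snd L ∘ (pr1 L _ _ ∘ k)) Ew); now cat.
- generalize (f_equal (fun k => pr2 L _ _ ∘ k) Ew); now cat.
Qed.

Variables (U : Functor H A) (V : Functor G B).
Hypotheses (sq0 : f0 K ∘ f0 U = f0 V ∘ f0 F) (sq1 : f1 K ∘ f1 U = f1 V ∘ f1 F).

Local Notation E0 := (pb L (f0 F) (dom G)).
Let h_ : Hom E0 (obj H) := pr1 L (f0 F) (dom G).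
Let g_ : Hom E0 (arr G) := pr2 L (f0 F) (dom G).

(* [l x] lifts the inverse of [V g], for [x = (h, g : F h -> y)], to an arrow
   ending at [U h]; its domain is the value forced on the diagonal at [y]. *)
Variable l : Hom E0 (arr A).
Hypotheses (cod_l : cod A ∘ l = f0 U ∘ h_)
  (K_l : f1 K ∘ l = inv B ∘ (f1 V ∘ g_)).

(** For [x = (h, g)] and [x' = (h', g')], fullness gives locally [w : h -> h'] with
    [F w = g * g'^-1]. Then [l x * U w] ends at [U h'] and lies over [V g'^-1], so it is [l x']. *)
Lemma comma_lift_eq (W : C) (x x' : Hom W E0) :
  cod G ∘ (g_ ∘ x) = cod G ∘ (g_ ∘ x') ->
  dom A ∘ (l ∘ x) = dom A ∘ (l ∘ x').
Proof.
intro E.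
assert (Ec : cod G ∘ (g_ ∘ x) = dom G ∘ (inv G ∘ (g_ ∘ x'))) by now cat.
destruct (@full_local W (h_ ∘ x) (h_ ∘ x')
  (mulg (g_ ∘ x) (inv G ∘ (g_ ∘ x')))) as (T & p & w & Hp & Ed & Ecw & Ew).
{ rewrite dom_mulg by exact Ec; apply comma_dom. }
{ rewrite cod_mulg by exact Ec; cat; apply comma_dom. }
apply (regular_epi_epi Hp).
assert (El : cod A ∘ (l ∘ (x ∘ p)) = dom A ∘ (f1 U ∘ w)).
{ rewrite (comp_eq_l cod_l); cat; now rewrite Ed; cat. }
assert (Ecp : cod G ∘ (g_ ∘ (x ∘ p)) = dom G ∘ (inv G ∘ (g_ ∘ (x' ∘ p)))).
{ generalize (f_equal (fun k => k ∘ p) E); now cat. }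
enough (Eq : mulg (l ∘ (x ∘ p)) (f1 U ∘ w) = l ∘ (x' ∘ p)).
{ cat; now rewrite <- Eq, dom_mulg. }
apply (discrete_fibration_inj hK).
- rewrite cod_mulg, (comp_eq_l cod_l) by exact El; cat; now rewrite Ecw; cat.
- rewrite functor_mulg, (comp_eq_l sq1), !(comp_eq_l K_l) by exact El; cat.
  rewrite Ew, mulg_comp by exact Ec; cat.
  rewrite functor_mulg, functor_inv by exact Ecp.
  rewrite <- mulg_assoc, mulVg; cat; auto.
  + apply mulg_idl; cat; cat in Ecp; now rewrite Ecp.
  + cat in Ecp; now rewrite Ecp.
Qed.

Lemma full_esssurj_diagonal : exists D : Functor G A,
  f0 D ∘ f0 F = f0 U /\ f1 D ∘ f1 F = f1 U /\
  f0 K ∘ f0 D = f0 V /\ f1 K ∘ f1 D = f1 V.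
Proof.
destruct (regular_epi_descent (x := dom A ∘ l) hsurj) as (D0 & ED0).
{ intros W a b E; cat in E; cat; now apply comma_lift_eq. }
fold g_ in ED0.
assert (ED0x : forall (W : C) (x : Hom W E0),
  D0 ∘ (cod G ∘ (g_ ∘ x)) = dom A ∘ (l ∘ x)).
{ intros W x; generalize (f_equal (fun k => k ∘ x) ED0); now cat. }
assert (KD0 : f0 K ∘ D0 = f0 V).
{ apply (regular_epi_epi hsurj); fold g_.
  rewrite comp_reassoc, ED0, <- f_dom_l, K_l; now cat. }
destruct (discrete_fibration_lift hK (a := D0 ∘ cod G) (b := f1 V))
  as (D1 & cod_D1 & KD1).
{ now rewrite comp_assoc, KD0, f_cod. }
(* Locally the domain of an arrow [t] is the codomain of [g] for some [x = (h, g)]. With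
   [y = (h, g * t)], both [D1 t * l y] and [l x] end at [U h] and lie over [V g^-1], so their
   domains agree. *)
assert (dom_D1 : dom A ∘ D1 = D0 ∘ dom G).
{ destruct (regular_epi_local hC (dom G) hsurj) as (T & t & x & Ht & Ex).
  cat in Ex; fold g_ in Ex.
  apply (regular_epi_epi Ht); cat.
  assert (Ey : f0 F ∘ (h_ ∘ x) = dom G ∘ mulg (g_ ∘ x) t).
  { rewrite dom_mulg by exact Ex; symmetry; apply comma_dom. }
  set (y := pbpair L _ _ Ey : Hom T E0).
  assert (hy : h_ ∘ y = h_ ∘ x) by apply pbpair_pr1.
  assert (gy : g_ ∘ y = mulg (g_ ∘ x) t) by apply pbpair_pr2.
  assert (El : cod A ∘ (D1 ∘ t) = dom A ∘ (l ∘ y)).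
  { rewrite (comp_eq_l cod_D1), <- ED0x, gy, cod_mulg by exact Ex; now cat. }
  rewrite <- Ex, ED0x.
  enough (Eq : mulg (D1 ∘ t) (l ∘ y) = l ∘ x) by now rewrite <- Eq, dom_mulg.
  apply (discrete_fibration_inj hK).
  - rewrite cod_mulg, !(comp_eq_l cod_l) by exact El; cat; now rewrite hy.
  - rewrite functor_mulg, !(comp_eq_l K_l), (comp_eq_l KD1) by exact El; cat.
    rewrite gy, functor_mulg, inv_mulg by (cat; now rewrite ?Ex).
    rewrite <- mulg_assoc, mulgV by (cat; now rewrite ?Ex).
    apply mulg_idl; cat; now rewrite Ex. }
destruct (functor_over hK dom_D1 cod_D1 KD0 KD1) as (D & <- & <-).
(* At the elements [(a, 1)] of [E0] the lift [l] is an identity of [U a]. *)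
assert (DF : f0 D ∘ f0 F = f0 U).
{ assert (Ex : f0 F ∘ idm (obj H) = dom G ∘ (ide G ∘ f0 F)) by now cat.
  set (x := pbpair L _ _ Ex : Hom (obj H) E0).
  assert (hx : h_ ∘ x = idm (obj H)) by apply pbpair_pr1.
  assert (gx : g_ ∘ x = ide G ∘ f0 F) by apply pbpair_pr2.
  transitivity (dom A ∘ (l ∘ x)).
  - rewrite <- ED0x, gx; now cat.
  - replace (l ∘ x) with (ide A ∘ f0 U); [now cat|].
    apply (discrete_fibration_inj hK).
    + rewrite (comp_eq_l cod_l); cat; now rewrite hx; cat.
    + rewrite (comp_eq_l K_l); cat; rewrite gx; cat.
      now rewrite inv_ide, sq0. }
exists D; repeat split; auto.
apply (discrete_fibration_inj hK).
- cat; now rewrite <- (comp_eq_l DF).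
- now rewrite (comp_eq_l KD1), sq1.
Qed.

(** Any diagonal sends [g^-1] to a lift with the codomain and image prescribed for [l]; comparing
    domains fixes its object part on [E0]. *)
Lemma esssurj_diagonal_unique (D : Functor G A) :
  f0 D ∘ f0 F = f0 U -> f1 K ∘ f1 D = f1 V ->
  f0 D ∘ (cod G ∘ g_) = dom A ∘ l.
Proof.
intros DF KD.
replace l with (f1 D ∘ (inv G ∘ g_)); [now cat|].
apply (discrete_fibration_inj hK).
- rewrite cod_l; cat.
  rewrite <- DF, comp_reassoc; f_equal; symmetry; apply pb_sq.
- now rewrite (comp_eq_l KD), K_l, functor_inv.
Qed.

End FullEssSurjFinal.

Lemma full_esssurj_final (hC : regular L) (H G : Groupoid L)
    (F : Functor H G) :
  full F -> essentially_surjective F -> final F.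
Proof.
intros hfull hsurj A B K hK U V E.
assert (sq0 : f0 K ∘ f0 U = f0 V ∘ f0 F) by exact (f_equal (@f0 _ _ _ _) E).
assert (sq1 : f1 K ∘ f1 U = f1 V ∘ f1 F) by exact (f_equal (@f1 _ _ _ _) E).
destruct (discrete_fibration_lift hK (a := f0 U ∘ pr1 L (f0 F) (dom G))
  (b := inv B ∘ (f1 V ∘ pr2 L (f0 F) (dom G)))) as (l & cod_l & K_l).
{ cat; now rewrite (comp_eq_l sq0), comp_reassoc, pb_sq. }
destruct (full_esssurj_diagonal hC hfull hsurj hK sq0 sq1 cod_l K_l)
  as (D & DF0 & DF1 & KD0 & KD1).
exists D; split; [split; apply functor_ext; assumption|].
intros D' [DF' KD'].
assert (DF0' : f0 D' ∘ f0 F = f0 U) by exact (f_equal (@f0 _ _ _ _) DF').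
assert (KD1' : f1 K ∘ f1 D' = f1 V) by exact (f_equal (@f1 _ _ _ _) KD').
assert (E0 : f0 D = f0 D').
{ apply (regular_epi_epi hsurj).
  now rewrite !(esssurj_diagonal_unique hK cod_l K_l). }
apply functor_ext; [exact E0|].
apply (discrete_fibration_inj hK).
- now rewrite !f_cod, E0.
- now rewrite KD1, KD1'.
Qed.

End DiscreteFibrations.

(** * The groupoid of a right action *)

(* [act (a, g)] is defined for [g : y -> k a] and lies over [y]: the arrow [g]
   lifts to an arrow [act (a, g) -> a]. *)
Record action (C : Category) (L : FinitelyComplete C) (G : Groupoid L)
    (A0 : C) (k : Hom A0 (obj G)) : Type := {
  act : Hom (pb L k (cod G)) A0;
  act_over : k ∘ act = dom G ∘ pr2 L k (cod G);
  act_unit : forall (W : C) (z : Hom W (pb L k (cod G))),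
    pr2 L k (cod G) ∘ z = ide G ∘ (k ∘ (pr1 L k (cod G) ∘ z)) ->
    act ∘ z = pr1 L k (cod G) ∘ z;
  act_mul : forall (W : C) (z z' z'' : Hom W (pb L k (cod G))),
    pr1 L k (cod G) ∘ z = act ∘ z' ->
    pr1 L k (cod G) ∘ z'' = pr1 L k (cod G) ∘ z' ->
    pr2 L k (cod G) ∘ z'' =
      mulg (pr2 L k (cod G) ∘ z) (pr2 L k (cod G) ∘ z') ->
    act ∘ z'' = act ∘ z
}.

Section ActionGroupoid.
Variables (C : Category) (L : FinitelyComplete C) (G : Groupoid L).
Variables (A0 : C) (k : Hom A0 (obj G)) (T : action k).

Local Notation A1 := (pb L k (cod G)).
Local Notation p1 := (pr1 L k (cod G)).
Local Notation p2 := (pr2 L k (cod G)).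
Local Notation A2 := (pb L p1 (act T)).
Local Notation q1 := (pr1 L p1 (act T)).
Local Notation q2 := (pr2 L p1 (act T)).

Lemma act_over_l (W : C) (z : Hom W A1) : k ∘ (act T ∘ z) = dom G ∘ (p2 ∘ z).
Proof. rewrite (comp_eq_l (act_over T)); apply comp_reassoc. Qed.

Lemma action_ide_comm : k ∘ idm A0 = cod G ∘ (ide G ∘ k).
Proof. now cat. Qed.

Lemma action_composable (W : C) (z z' : Hom W A1) :
  p1 ∘ z = act T ∘ z' -> cod G ∘ (p2 ∘ z) = dom G ∘ (p2 ∘ z').
Proof. intro E; now rewrite <- pb_sq_l, E, act_over_l. Qed.

Lemma action_mul_comm :
  k ∘ (p1 ∘ q2) = cod G ∘ mulg (p2 ∘ q1) (p2 ∘ q2).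
Proof.
rewrite cod_mulg by apply action_composable, pb_sq.
apply pb_sq_l.
Qed.

Lemma action_inv_comm : k ∘ act T = cod G ∘ (inv G ∘ p2).
Proof. rewrite act_over; now cat. Qed.

Definition action_ide : Hom A0 A1 := pbpair L _ _ action_ide_comm.
Definition action_mul : Hom A2 A1 := pbpair L _ _ action_mul_comm.
Definition action_inv : Hom A1 A1 := pbpair L _ _ action_inv_comm.

Lemma action_p1_mul (W : C) (z z' : Hom W A1) (E : p1 ∘ z = act T ∘ z') :
  p1 ∘ (action_mul ∘ pbpair L z z' E) = p1 ∘ z'.
Proof. unfold action_mul; now cat. Qed.

Lemma action_p2_mul (W : C) (z z' : Hom W A1) (E : p1 ∘ z = act T ∘ z') :
  p2 ∘ (action_mul ∘ pbpair L z z' E) = mulg (p2 ∘ z) (p2 ∘ z').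
Proof.
unfold action_mul; cat.
rewrite mulg_comp by apply action_composable, pb_sq; now cat.
Qed.

Lemma act_action_ide : act T ∘ action_ide = idm A0.
Proof. rewrite act_unit; unfold action_ide; now cat. Qed.

Lemma act_action_mul : act T ∘ action_mul = act T ∘ q1.
Proof.
apply act_mul with (z' := q2); unfold action_mul; cat; auto using pb_sq.
Qed.

Lemma act_action_inv : act T ∘ action_inv = p1.
Proof.
(* Acting by [g] and then by [g^-1] amounts to acting by an identity. *)
assert (E : k ∘ p1 = cod G ∘ (ide G ∘ (k ∘ p1))) by now cat.
transitivity (act T ∘ pbpair L _ _ E).
- symmetry; apply act_mul with (z' := idm A1); unfold action_inv; cat; auto.
  now rewrite mulVg, pb_sq.
- rewrite act_unit; now cat.
Qed.

Definition action_groupoid : Groupoid L.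
Proof.
unshelve refine {| obj := A0; arr := A1; dom := act T; cod := p1;
  ide := action_ide; mul := action_mul; inv := action_inv |}.
- exact act_action_ide.
- apply pbpair_pr1.
- exact act_action_mul.
- apply pbpair_pr1.
- exact act_action_inv.
- apply pbpair_pr1.
(* Equations between arrows are tested on the two projections: the first compares codomains, the
   second is the corresponding law of [G]. *)
- apply (@pb_jm C L _ _ _ k (cod G)); rewrite ?action_p1_mul, ?action_p2_mul.
  + now cat.
  + unfold action_ide; cat; apply mulg_idl; cat; apply act_over.
- apply (@pb_jm C L _ _ _ k (cod G)); rewrite ?action_p1_mul, ?action_p2_mul;
    unfold action_ide; cat.
  + reflexivity.
  + apply mulg_idr; cat; apply pb_sq.
- intros X f g h fg gh; apply (@pb_jm C L _ _ _ k (cod G)).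
  + now rewrite !action_p1_mul.
  + rewrite !action_p2_mul; apply mulg_assoc; now apply action_composable.
- apply (@pb_jm C L _ _ _ k (cod G)); rewrite ?action_p1_mul, ?action_p2_mul;
    unfold action_ide, action_inv; cat.
  + reflexivity.
  + now rewrite mulgV, act_over.
- apply (@pb_jm C L _ _ _ k (cod G)); rewrite ?action_p1_mul, ?action_p2_mul;
    unfold action_ide, action_inv; cat.
  + reflexivity.
  + now rewrite mulVg, pb_sq.
Defined.

Definition action_projection : Functor action_groupoid G.
Proof.
unshelve refine {| f0 := k : Hom (obj action_groupoid) (obj G);
  f1 := p2 : Hom (arr action_groupoid) (arr G) |}; cbn.
- symmetry; apply act_over.
- symmetry; apply pb_sq.
- unfold action_ide; now cat.
- rewrite mulgE; unfold action_mul; now cat.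
Defined.

Lemma action_projection_discrete : discrete_fibration action_projection.
Proof. apply pb_is_pullback. Qed.

End ActionGroupoid.

(** * Quotient of the comma object *)

Section CommaQuotient.
Variables (C : Category) (L : FinitelyComplete C) (hC : barr_exact L).
Variables (H G : Groupoid L) (F : Functor H G).

Local Notation E0 := (pb L (f0 F) (dom G)).
Local Notation h_ := (pr1 L (f0 F) (dom G)).
Local Notation g_ := (pr2 L (f0 F) (dom G)).

(* [H] acts on [E0] by [v * (h', g') = (h, F v * g')] for [v : h -> h']. *)
Definition link (W : C) (x y : Hom W E0) (w : Hom W (arr H)) : Prop :=
  dom H ∘ w = h_ ∘ x /\ cod H ∘ w = h_ ∘ y /\
  mulg (f1 F ∘ w) (g_ ∘ y) = g_ ∘ x.

Definition linked (W : C) (x y : Hom W E0) : Prop :=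
  exists (V : C) (p : Hom V W) (w : Hom V (arr H)),
    regular_epi p /\ link (x ∘ p) (y ∘ p) w.

Lemma link_composable (W : C) (x y : Hom W E0) (w : Hom W (arr H)) :
  link x y w -> cod G ∘ (f1 F ∘ w) = dom G ∘ (g_ ∘ y).
Proof. intros (_ & E & _); now rewrite f_cod_l, E, comma_dom. Qed.

Lemma link_comp (V W : C) (x y : Hom W E0) (w : Hom W (arr H))
    (p : Hom V W) : link x y w -> link (x ∘ p) (y ∘ p) (w ∘ p).
Proof.
intro l; pose proof (link_composable l) as Ec; destruct l as (E1 & E2 & E3).
repeat split; rewrite !comp_assoc, ?E1, ?E2; cat; auto.
rewrite <- (comp_reassoc _ x), <- E3, mulg_comp by exact Ec; now cat.
Qed.

Lemma link_trans (W : C) (x y z : Hom W E0) (v w : Hom W (arr H)) :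
  link x y v -> link y z w -> link x z (mulg v w).
Proof.
intros l l'; pose proof (link_composable l) as Ec.
pose proof (link_composable l') as Ec'.
destruct l as (E1 & E2 & E3), l' as (E1' & E2' & E3').
assert (E : cod H ∘ v = dom H ∘ w) by now rewrite E2.
repeat split.
- now rewrite dom_mulg.
- now rewrite cod_mulg.
- assert (Ef : cod G ∘ (f1 F ∘ v) = dom G ∘ (f1 F ∘ w)) by (cat; now rewrite E).
  now rewrite functor_mulg, mulg_assoc, E3'.
Qed.

Lemma link_cod (W : C) (x y : Hom W E0) (w : Hom W (arr H)) :
  link x y w -> cod G ∘ (g_ ∘ x) = cod G ∘ (g_ ∘ y).
Proof.
intro l; pose proof (link_composable l) as Ec; destruct l as (_ & _ & <-).
now apply cod_mulg.
Qed.

(** The arrow [w] acts on the left and [t] on the right, so the same [w] still links after the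
    translation. Hence translation by [G] is compatible with the quotient. *)
Lemma link_translate (W : C) (x y x' y' : Hom W E0) (w : Hom W (arr H))
    (t : Hom W (arr G)) :
  link x y w -> cod G ∘ (g_ ∘ y) = dom G ∘ t ->
  h_ ∘ x' = h_ ∘ x -> g_ ∘ x' = mulg (g_ ∘ x) t ->
  h_ ∘ y' = h_ ∘ y -> g_ ∘ y' = mulg (g_ ∘ y) t -> link x' y' w.
Proof.
intros l Et Ehx Egx Ehy Egy; pose proof (link_composable l) as Ec.
destruct l as (E1 & E2 & E3); repeat split.
- now rewrite Ehx.
- now rewrite Ehy.
- now rewrite Egx, Egy, <- E3, mulg_assoc.
Qed.

Lemma linked_refl (W : C) (x : Hom W E0) : linked x x.
Proof.
exists W, (idm W), (ide H ∘ (h_ ∘ x)); split; [apply regular_epi_idm|].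
unfold link; cat; repeat split; auto.
apply mulg_idl; symmetry; apply comma_dom.
Qed.

Lemma linked_sym (W : C) (x y : Hom W E0) : linked x y -> linked y x.
Proof.
intros (V & p & w & Hp & l); pose proof (link_composable l) as Ec.
destruct l as (E1 & E2 & E3).
exists V, p, (inv H ∘ w); split; [exact Hp|].
repeat split; [now cat | now cat |].
now rewrite <- E3, functor_inv; apply mulKg.
Qed.

Lemma linked_trans (W : C) (x y z : Hom W E0) :
  linked x y -> linked y z -> linked x z.
Proof.
intros (V & p & w & Hp & l) (V' & p' & w' & Hp' & l').
pose proof (proj1 hC) as hR.
destruct (regular_epi_local hR p Hp') as (T & t & t' & Ht & Et).
exists T, (p ∘ t), (mulg (w ∘ t) (w' ∘ t')); split.
{ now apply (regular_epi_comp hR). }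
apply (link_comp t) in l; apply (link_comp t') in l'.
rewrite !comp_reassoc in l, l'; rewrite Et in l'.
apply (link_trans l l').
Qed.

Lemma comma_quotient : exists (Q : C) (k : Hom E0 Q), regular_epi k /\
  forall (W : C) (x y : Hom W E0), k ∘ x = k ∘ y <-> linked x y.
Proof.
(* The pairs [(v : h -> h', g : F h' -> y)] parametrize all links: [s1] returns [(h, F v * g)] and
   [s2] returns [(h', g)]. *)
set (v := pr1 L (f0 F ∘ cod H) (dom G)).
set (g := pr2 L (f0 F ∘ cod H) (dom G)).
assert (E : f0 F ∘ (cod H ∘ v) = dom G ∘ g).
{ rewrite comp_assoc; apply pb_sq. }
assert (Ec : cod G ∘ (f1 F ∘ v) = dom G ∘ g) by now cat.
assert (E1 : f0 F ∘ (dom H ∘ v) = dom G ∘ mulg (f1 F ∘ v) g).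
{ rewrite dom_mulg by exact Ec; now cat. }
set (s1 := pbpair L _ _ E1); set (s2 := pbpair L _ _ E).
assert (HS : forall (W : C) (x y : Hom W E0),
  locally_related s1 s2 x y <-> linked x y).
{ intros W x y; split.
  - intros (V & p & s & Hp & Ex & Ey); exists V, p, (v ∘ s).
    split; [exact Hp|]; rewrite <- Ex, <- Ey; unfold link, s1, s2; cat.
    repeat split; auto; rewrite mulg_comp by exact Ec; now cat.
  - intros (V & p & w & Hp & l); pose proof (link_composable l) as Ew.
    destruct l as (El1 & El2 & El3).
    assert (Es : f0 F ∘ cod H ∘ w = dom G ∘ (g_ ∘ (y ∘ p))).
    { rewrite <- Ew; now cat. }
    exists V, p, (pbpair L _ _ Es); split; [exact Hp|].
    split; apply (@pb_jm C L _ _ _ (f0 F) (dom G)); unfold s1, s2; cat.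
    + exact El1.
    + rewrite mulg_comp by exact Ec; cat; exact El3.
    + exact El2.
    + reflexivity. }
destruct (exact_quotient hC (s1 := s1) (s2 := s2)) as (Q & k & Hk & Ek).
- intros; apply HS, linked_refl.
- intros W x y R; apply HS, linked_sym, HS, R.
- intros W x y z R R'; apply HS; apply linked_trans with y; now apply HS.
- exists Q, k; split; [exact Hk|]; intros; now rewrite Ek.
Qed.

Variables (Q : C) (k : Hom E0 Q).
Hypotheses (hk : regular_epi k)
  (k_eq : forall (W : C) (x y : Hom W E0), k ∘ x = k ∘ y <-> linked x y).

Lemma comma_quotient_translate (W : C) (x y x' y' : Hom W E0)
    (t : Hom W (arr G)) :
  k ∘ x = k ∘ y -> cod G ∘ (g_ ∘ y) = dom G ∘ t ->
  h_ ∘ x' = h_ ∘ x -> g_ ∘ x' = mulg (g_ ∘ x) t ->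
  h_ ∘ y' = h_ ∘ y -> g_ ∘ y' = mulg (g_ ∘ y) t -> k ∘ x' = k ∘ y'.
Proof.
rewrite !k_eq; intros (V & p & w & Hp & l) Et Ehx Egx Ehy Egy.
exists V, p, w; split; [exact Hp|].
assert (Ex : cod G ∘ (g_ ∘ (x ∘ p)) = dom G ∘ (t ∘ p)).
{ rewrite (link_cod l), !comp_assoc; f_equal; now rewrite !comp_reassoc. }
assert (Etx : cod G ∘ (g_ ∘ x) = dom G ∘ t).
{ apply (regular_epi_epi Hp); now cat. }
apply link_translate with (x := x ∘ p) (y := y ∘ p) (t := t ∘ p); auto.
- now rewrite <- (link_cod l).
- now rewrite !comp_assoc, Ehx.
- now rewrite comp_assoc, Egx, mulg_comp, comp_reassoc.
- now rewrite !comp_assoc, Ehy.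
- now rewrite comp_assoc, Egy, mulg_comp, comp_reassoc.
Qed.

Lemma comma_quotient_over :
  exists k0 : Hom Q (obj G), k0 ∘ k = cod G ∘ g_.
Proof.
apply (regular_epi_descent hk).
intros V a b E; apply k_eq in E; destruct E as (T & p & w & Hp & l).
apply (regular_epi_epi Hp); cat; exact (link_cod l).
Qed.

Variable k0 : Hom Q (obj G).
Hypothesis k0_k : k0 ∘ k = cod G ∘ g_.

Lemma k0_k_l (W : C) (x : Hom W E0) : k0 ∘ (k ∘ x) = cod G ∘ (g_ ∘ x).
Proof. now rewrite (comp_eq_l k0_k), comp_reassoc. Qed.

Local Notation p1 := (pr1 L k0 (cod G)).
Local Notation p2 := (pr2 L k0 (cod G)).

(** The action on representatives. Arrows of [G] compose with [E0] covariantly while [action] is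
    contravariant, whence the inverse. It is a relation because elements of [Q] have representatives
    only locally. *)
Definition acts (W : C) (z : Hom W (pb L k0 (cod G))) (x x' : Hom W E0) :
    Prop :=
  k ∘ x = p1 ∘ z /\ h_ ∘ x' = h_ ∘ x /\
  g_ ∘ x' = mulg (g_ ∘ x) (inv G ∘ (p2 ∘ z)).

Lemma acts_composable (W : C) (z : Hom W (pb L k0 (cod G))) (x : Hom W E0) :
  k ∘ x = p1 ∘ z -> cod G ∘ (g_ ∘ x) = dom G ∘ (inv G ∘ (p2 ∘ z)).
Proof. intro E; cat; now rewrite <- k0_k_l, E, pb_sq_l. Qed.

Lemma acts_ex (W : C) (z : Hom W (pb L k0 (cod G))) (x : Hom W E0) :
  k ∘ x = p1 ∘ z -> exists x' : Hom W E0, acts z x x'.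
Proof.
intro E; pose proof (acts_composable E) as Ec.
assert (E' : f0 F ∘ (h_ ∘ x) = dom G ∘ mulg (g_ ∘ x) (inv G ∘ (p2 ∘ z))).
{ now rewrite dom_mulg, comma_dom. }
exists (pbpair L _ _ E'); unfold acts; now cat.
Qed.

Lemma acts_eq (W : C) (z : Hom W (pb L k0 (cod G))) (x x' y y' : Hom W E0) :
  acts z x x' -> acts z y y' -> k ∘ x' = k ∘ y'.
Proof.
intros (E1 & E2 & E3) (E1' & E2' & E3').
apply comma_quotient_translate
  with (x := x) (y := y) (t := inv G ∘ (p2 ∘ z)); auto.
- now rewrite E1.
- now apply acts_composable.
Qed.

Lemma acts_comp (V W : C) (z : Hom W (pb L k0 (cod G))) (x x' : Hom W E0)
    (p : Hom V W) : acts z x x' -> acts (z ∘ p) (x ∘ p) (x' ∘ p).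
Proof.
intros (E1 & E2 & E3); pose proof (acts_composable E1) as Ec.
repeat split.
- now rewrite !comp_assoc, E1.
- now rewrite !comp_assoc, E2.
- rewrite comp_assoc, E3, mulg_comp by exact Ec; now cat.
Qed.

Lemma acts_local (W : C) (z : Hom W (pb L k0 (cod G))) :
  exists (V : C) (p : Hom V W) (x x' : Hom V E0),
    regular_epi p /\ acts (z ∘ p) x x'.
Proof.
destruct (regular_epi_local (proj1 hC) (p1 ∘ z) hk) as (V & p & x & Hp & Ex).
rewrite comp_reassoc in Ex; destruct (acts_ex Ex) as (x' & Ex').
now exists V, p, x, x'.
Qed.

(** The action is first defined on a cover where the generic element has a representative; it
    descends because [acts_eq] makes the class of the result independent of the choice. *)
Lemma comma_quotient_act : exists a : Hom (pb L k0 (cod G)) Q,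
  forall (W : C) (z : Hom W (pb L k0 (cod G))) (x x' : Hom W E0),
    acts z x x' -> a ∘ z = k ∘ x'.
Proof.
destruct (acts_local (idm (pb L k0 (cod G)))) as (V & p & x & x' & Hp & Hx).
rewrite comp_idl in Hx.
destruct (regular_epi_descent (x := k ∘ x') Hp) as (a & Ea).
{ intros T b b' E; rewrite !comp_reassoc.
  apply acts_eq with (z := p ∘ b) (x := x ∘ b) (y := x ∘ b').
  - now apply acts_comp.
  - rewrite E; now apply acts_comp. }
exists a; intros W z y y' Hy.
destruct (regular_epi_local (proj1 hC) z Hp) as (T & q & v & Hq & Ev).
apply (regular_epi_epi Hq); rewrite comp_reassoc, <- Ev, (comp_eq_l Ea).
rewrite !comp_reassoc; apply acts_eq with (z := p ∘ v) (x := x ∘ v) (y := y ∘ q).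
- now apply acts_comp.
- rewrite Ev; now apply acts_comp.
Qed.

Lemma comma_quotient_action : exists T : action k0,
  forall (W : C) (z : Hom W (pb L k0 (cod G))) (x x' : Hom W E0),
    acts z x x' -> act T ∘ z = k ∘ x'.
Proof.
destruct comma_quotient_act as (a & Ha).
unshelve eexists {| act := a |}; [| | |exact Ha].
- destruct (acts_local (idm (pb L k0 (cod G)))) as (V & p & x & x' & Hp & Hx).
  rewrite comp_idl in Hx; pose proof Hx as (E1 & _ & E3).
  apply (regular_epi_epi Hp); rewrite comp_reassoc, (Ha _ _ _ _ Hx), k0_k_l, E3.
  rewrite cod_mulg by now apply acts_composable.
  now cat.
- intros W z Ez.
  destruct (acts_local z) as (V & p & x & x' & Hp & Hx).
  apply (regular_epi_epi Hp); rewrite !comp_reassoc, (Ha _ _ _ _ Hx).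
  destruct Hx as (E1 & E2 & E3); rewrite <- E1; f_equal.
  apply (@pb_jm C L _ _ _ (f0 F) (dom G)); [exact E2|].
  rewrite E3, <- (comp_reassoc _ z), Ez; cat.
  rewrite inv_ide, <- E1, k0_k_l; now apply mulg_idr.
(* If [z'] takes [x] to [x'] and [z] takes [x'] to [x''], then [z''] takes [x] to [x''], since
   inversion reverses products. *)
- intros W z z' z'' E1 E2 E3.
  destruct (acts_local z') as (V & p & x & x' & Hp & Hx).
  apply (f_equal (fun m => m ∘ p)) in E1, E2.
  rewrite !comp_reassoc in E1, E2; rewrite (Ha _ _ _ _ Hx) in E1.
  destruct (acts_ex (eq_sym E1)) as (x'' & Hx').
  apply (regular_epi_epi Hp); rewrite !comp_reassoc, (Ha _ _ _ _ Hx').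
  apply Ha with (x := x).
  destruct Hx as (Ex1 & Ex2 & Ex3), Hx' as (Ex1' & Ex2' & Ex3').
  pose proof (acts_composable Ex1) as Ec; pose proof (acts_composable Ex1') as Ec'.
  rewrite Ex3, cod_mulg in Ec' by exact Ec; cat in Ec; cat in Ec'.
  repeat split.
  + now rewrite E2.
  + now rewrite Ex2'.
  + rewrite Ex3', Ex3, mulg_assoc by (cat; auto); f_equal.
    rewrite <- (comp_reassoc p2 z''), E3, mulg_comp, inv_mulg; cat; auto.
    apply (regular_epi_epi Hp); now cat.
Qed.

End CommaQuotient.

(** * Final functors are full and essentially surjective *)

Lemma final_full_esssurj (C : Category) (L : FinitelyComplete C)
    (hC : barr_exact L) (H G : Groupoid L) (F : Functor H G) :
  final F -> full F /\ essentially_surjective F.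
Proof.
intro hF; pose proof (proj1 hC) as hR.
destruct (comma_quotient hC F) as (Q & k & hk & k_eq).
destruct (comma_quotient_over hk k_eq) as (k0 & k0_k).
destruct (comma_quotient_action hC hk k_eq k0_k) as (T & HT).
assert (Eu : f0 F ∘ idm (obj H) = dom G ∘ (ide G ∘ f0 F)) by now cat.
set (u := pbpair L _ _ Eu).
assert (hu : forall (W : C) (a : Hom W (obj H)),
  pr1 L (f0 F) (dom G) ∘ (u ∘ a) = a) by (intros; unfold u; now cat).
assert (gu : forall (W : C) (a : Hom W (obj H)),
  pr2 L (f0 F) (dom G) ∘ (u ∘ a) = ide G ∘ (f0 F ∘ a))
  by (intros; unfold u; now cat).
assert (k0u : k0 ∘ (k ∘ u) = f0 F).
{ rewrite (comp_eq_l k0_k); unfold u; now cat. }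
(* The inverse of an arrow [g : F a -> F b] represents, as an object of the
   comma object over [b], the action of [g] on [u b]. *)
assert (Hu : forall (W : C) (z : Hom W (pb L k0 (cod G))) (a b : Hom W (obj H)),
  pr1 L k0 (cod G) ∘ z = k ∘ (u ∘ b) ->
  dom G ∘ (pr2 L k0 (cod G) ∘ z) = f0 F ∘ a ->
  exists x' : Hom W _, act T ∘ z = k ∘ x' /\
    pr1 L (f0 F) (dom G) ∘ x' = b /\
    pr2 L (f0 F) (dom G) ∘ x' = inv G ∘ (pr2 L k0 (cod G) ∘ z)).
{ intros W z a b Ez Ea.
  destruct (acts_ex k0_k (eq_sym Ez)) as (x' & Hx').
  exists x'; split; [exact (HT _ _ _ _ Hx')|].
  destruct Hx' as (_ & Eh & Eg); rewrite Eh, Eg, hu, gu; split; auto.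
  apply mulg_idl; cat.
  rewrite <- pb_sq_l, Ez.
  generalize (f_equal (fun m => m ∘ b) k0u); rewrite !comp_reassoc; auto. }
set (K := action_projection T).
assert (EU1 : k0 ∘ (k ∘ u ∘ cod H) = cod G ∘ f1 F).
{ now rewrite comp_assoc, k0u, f_cod. }
set (U1 := pbpair L _ _ EU1).
(* For [v : a -> b], acting by [F v] on the class of [(b, 1)] gives that of [(b, (F v)^-1)], and [v]
   itself links [(a, 1)] to this pair. *)
assert (EUd : act T ∘ U1 = k ∘ u ∘ dom H).
{ destruct (Hu _ U1 (dom H) (cod H)) as (x' & -> & Eh & Eg);
    [unfold U1; now cat | unfold U1; now cat |].
  rewrite comp_reassoc; symmetry; apply k_eq.
  exists (arr H), (idm _), (idm _); split; [apply regular_epi_idm|].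
  unfold link; rewrite !comp_idr, Eh, Eg, hu, gu; repeat split.
  unfold U1; rewrite pbpair_pr2, mulgV, f_dom; reflexivity. }
destruct (functor_over (action_projection_discrete T) (V := F)
  (D0 := k ∘ u) (D1 := U1) EUd (pbpair_pr1 _ _) k0u (pbpair_pr2 _ _))
  as (U & EU0 & EU1').
destruct (hF _ _ K (action_projection_discrete T) U (functor_id G))
  as (D & (DF & KD) & _).
{ apply functor_ext; cbn; rewrite comp_idl.
  - now rewrite EU0.
  - rewrite EU1'; apply pbpair_pr2. }
assert (DF0 : f0 D ∘ f0 F = k ∘ u).
{ rewrite <- EU0; exact (f_equal (@f0 _ _ _ _) DF). }
assert (KD0 : k0 ∘ f0 D = idm (obj G)) by exact (f_equal (@f0 _ _ _ _) KD).
assert (KD1 : pr2 L k0 (cod G) ∘ f1 D = idm (arr G))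
  by exact (f_equal (@f1 _ _ _ _) KD).
assert (cod_D : pr1 L k0 (cod G) ∘ f1 D = f0 D ∘ cod G) by exact (f_cod D).
assert (dom_D : act T ∘ f1 D = f0 D ∘ dom G) by exact (f_dom D).
split.
- set (ab := pr1 L (prod_map L (f0 F) (f0 F)) (domcod G)).
  set (g := pr2 L (prod_map L (f0 F) (f0 F)) (domcod G)).
  pose proof (pb_sq L (prod_map L (f0 F) (f0 F)) (domcod G)) as E.
  fold ab g in E; unfold prod_map, domcod in E.
  assert (Ea : dom G ∘ g = f0 F ∘ (fst L ∘ ab)).
  { generalize (f_equal (fun m => fst L ∘ m) E); now cat. }
  assert (Eb : cod G ∘ g = f0 F ∘ (snd L ∘ ab)).
  { generalize (f_equal (fun m => snd L ∘ m) E); now cat. }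
  destruct (Hu _ (f1 D ∘ g) (fst L ∘ ab) (snd L ∘ ab)) as (x' & Ex & Eh & Eg).
  { rewrite (comp_eq_l cod_D), comp_reassoc, Eb, (comp_eq_l DF0).
    apply comp_reassoc. }
  { now rewrite (comp_eq_l KD1), comp_idl. }
  rewrite (comp_eq_l KD1), comp_idl in Eg.
  (* The domain of [D g] is the class of [(a, 1)] because [D F = U], and that of [x' = (b, g^-1)] by
     the action. The resulting link is locally a [w : a -> b] with [F w * g^-1 = 1]. *)
  assert (R : k ∘ (u ∘ (fst L ∘ ab)) = k ∘ x').
  { rewrite <- Ex, (comp_eq_l dom_D), comp_reassoc, Ea, (comp_eq_l DF0).
    now rewrite comp_reassoc. }
  apply k_eq in R; destruct R as (V & p & w & Hp & l).
  pose proof (link_composable l) as Ec; destruct l as (E1 & E2 & E3).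
  rewrite comp_assoc, Eh, comp_reassoc in E2; rewrite !comp_reassoc, hu in E1.
  rewrite (comp_assoc _ x'), Eg in Ec, E3; rewrite !comp_reassoc in Ec.
  rewrite !comp_reassoc, gu in E3.
  apply (regular_epi_of_local hR); exists V, p, w; split; [exact Hp|].
  apply (@pb_jm C L _ _ _ (prod_map L (f0 F) (f0 F)) (domcod G)).
  + unfold phi, domcod; cat; apply (@prod_jm C L); cat.
    * exact E1.
    * exact E2.
  + unfold phi; cat.
    apply mulg_injr with (h := inv G ∘ (g ∘ p)); [exact Ec | now cat |].
    rewrite E3; cat; rewrite mulgV.
    generalize (f_equal (fun m => ide G ∘ (m ∘ p)) Ea); cat; auto.
(* A local lift of [D0] along the cover [k] is a local section of the map in question, as
   [k0 ∘ f0 D] is the identity. *)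
- apply (regular_epi_of_local hR).
  destruct (@regular_epi_local C L hR _ Q _ k (f0 D) hk) as (V & p & x & Hp & Ex).
  exists V, p, x; split; [exact Hp|].
  now rewrite <- k0_k, comp_reassoc, Ex, (comp_eq_l KD0), comp_idl.
Qed.

Theorem theorem4p2 (C : Category) (L : FinitelyComplete C)
    (hC : barr_exact L) (H G : Groupoid L) (F : Functor H G) :
  final F <-> full F /\ essentially_surjective F.
Proof.
split.
- now apply final_full_esssurj.
- intros [hfull hsurj]; exact (full_esssurj_final (proj1 hC) hfull hsurj).
Qed.
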